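(* Let $\alpha\in(0,1/2)$, $r\in(0,1]$ and $1\le\ell\le\infty$. Then $\lim_{n\to\infty}\mathrm{C}_\ell^{f_\alpha}(0,n,r)$ exists and equals $\mathrm{c}_\ell^{f_\alpha}(r)$.
   Context: For $\alpha\in(0,1/2)$ the continuous map $f_\alpha:[0,1]\to[0,1]$ is defined by: $f_\alpha(x)=x-1+2\alpha^{j-1}-\alpha^j$ for $x\in[1-\alpha^{j-1},1-\alpha^{j-1}+\alpha^j]$, $j\ge1$; $f_\alpha(x)=\frac{1-\alpha+\alpha^2}{2\alpha-1}(x-1)+\alpha^{j+1}\frac{2-\alpha}{2\alpha-1}$ for $x\in(1-\alpha^{j-1}+\alpha^j,1-\alpha^j)$, $j\ge1$; and $f_\alpha(1)=0$. For a word $u=u_1\dots u_k\in\{0,1\}^k$ put $\kappa(u)=(1-\alpha)\sum_{i=1}^k u_i\alpha^{i-1}$ and $I_\alpha(u)=[\kappa(u),\kappa(u)+\alpha^k]$. The measure $\mu_\alpha$ is the unique Borel probability measure on $[0,1]$ with $\mu_\alpha(I_\alpha(u))=2^{-k}$ for all $k\ge1$ and $u\in\{0,1\}^k$. Put $\varrho_\ell(x,y)=\sup\{|f_\alpha^i(x)-f_\alpha^i(y)| : 0\le i<\ell\}$. The correlation sum is $\mathrm{C}_\ell^{f_\alpha}(x,n,r)=\frac1{n^2}\#\{(i,j):0\le i,j<n,\ \varrho_\ell(f_\alpha^i(x),f_\alpha^j(x))\le r\}$ and the correlation integral is $\mathrm{c}_\ell^{f_\alpha}(r)=\mu_\alpha\times\mu_\alpha\{(x,y):\varrho_\ell(x,y)\le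 r\}$. *)

(* Defs.v *)
From HB Require Import structures.
From mathcomp Require Import all_boot all_order all_algebra.
From mathcomp Require Import all_classical all_reals all_analysis.
From mathcomp Require Import lra.

Set Implicit Arguments.
Unset Strict Implicit.
Unset Printing Implicit Defensive.

Import Order.TTheory GRing.Theory Num.Theory.
Import numFieldNormedType.Exports.

Local Open Scope classical_set_scope.
Local Open Scope ring_scope.

Definition f_lo (R : realType) (alpha : R) (j : nat) : R :=
  1 - alpha ^+ j.-1.

Definition f_mid (R : realType) (alpha : R) (j : nat) : R :=
  1 - alpha ^+ j.-1 + alpha ^+ j.

Definition f_hi (R : realType) (alpha : R) (j : nat) : R :=
  1 - alpha ^+ j.

Definition f_graph (R : realType) (alpha x y : R) : Prop :=
  [\/ exists j : nat, [/\ (1 <= j)%N, f_lo alpha j <= x <= f_mid alpha j &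
        y = x - 1 + 2 * alpha ^+ j.-1 - alpha ^+ j],
      exists j : nat, [/\ (1 <= j)%N, f_mid alpha j < x < f_hi alpha j &
        y = (1 - alpha + alpha ^+ 2) / (2 * alpha - 1) * (x - 1)
            + alpha ^+ j.+1 * ((2 - alpha) / (2 * alpha - 1))] |
      x = 1 /\ y = 0].

(* The piecewise map on [0, 1]; by [f_graph_ex] and [f_graph_uniq] the clauses
   determine its value there. Outside [0, 1] it is 0, a junk value. *)
Definition f_alpha (R : realType) (alpha x : R) : R := xget 0 (f_graph alpha x).

Lemma f_graph_ex (R : realType) (alpha x : R) (ha : 0 < alpha < 1 / 2)
  (hx : 0 <= x <= 1) : exists y, f_graph alpha x y.
Proof.
case: (eqVneq x 1) => [->|x1]; first by exists 0; apply: Or33.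
have xlt1 : 0 < 1 - x by rewrite subr_gt0 lt_neqAle x1; case/andP: hx.
have a1 : `|alpha| < 1.
  by rewrite ger0_norm; [case/andP: ha => *; lra | case/andP: ha => *; lra].
have ex : exists n, alpha ^+ n < 1 - x.
  have /cvgrPdist_lt /(_ _ xlt1) [N _ /(_ N (leqnn N))] := cvg_expr a1.
  rewrite /= sub0r normrN => h; exists N.
  by apply: le_lt_trans h; exact: ler_norm.
case: (ex_minnP ex) => -[|j] hj minj.
  by exfalso; move: hj hx; rewrite expr0 => ? /andP[? ?]; lra.
have lej : 1 - x <= alpha ^+ j.
  by rewrite leNgt; apply/negP => /minj; rewrite ltnn.
case: (leP x (f_mid alpha j.+1)) => hm.
  exists (x - 1 + 2 * alpha ^+ j - alpha ^+ j.+1); apply: Or31.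
  exists j.+1; split => //; rewrite hm andbT /f_lo /=; lra.
eexists; apply: Or32; exists j.+1; split; [by []| |reflexivity].
rewrite hm /f_hi /=; lra.
Qed.

Lemma f_mid_lt_f_hi (R : realType) (alpha : R) (j : nat)
  (ha : 0 < alpha < 1 / 2) (hj : (1 <= j)%N) :
  f_mid alpha j < f_hi alpha j.
Proof.
case: j hj => // j _; rewrite /f_mid /f_hi /= exprS.
case/andP: ha => a0 a2.
have : 0 < alpha ^+ j by apply: exprn_gt0.
move=> p; have : 0 < (1 / 2 - alpha) * alpha ^+ j by apply: mulr_gt0; lra.
by rewrite mulrBl => ?; lra.
Qed.

Lemma f_index_uniq (R : realType) (alpha x : R) (i j : nat)
  (ha : 0 < alpha < 1 / 2) (hi : (1 <= i)%N) (hj : (1 <= j)%N)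
  (xi : f_lo alpha i <= x < f_hi alpha i)
  (xj : f_lo alpha j <= x < f_hi alpha j) : i = j.
Proof.
wlog lt_ij : i j hi hj xi xj / (i < j)%N.
  by move=> H; case: (ltngtP i j) => // h; [exact: H | apply/esym; exact: H].
have : alpha ^+ j.-1 <= alpha ^+ i.
  apply: ler_wiXn2l; [lra|lra|].
  by rewrite -ltnS prednK.
by move: xi xj; rewrite /f_lo /f_hi => *; exfalso; lra.
Qed.

Lemma f_graph_uniq (R : realType) (alpha x y z : R) (ha : 0 < alpha < 1 / 2) :
  f_graph alpha x y -> f_graph alpha x z -> y = z.
Proof.
have lowmid j : (1 <= j)%N -> f_lo alpha j < f_mid alpha j.
  by move=> _; rewrite /f_lo /f_mid ltrDl exprn_gt0//; lra.
have fup1 j : f_hi alpha j < 1.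
  by rewrite /f_hi gtrDl oppr_lt0 exprn_gt0//; lra.
move=> [[i [i1 xi ->]]|[i [i1 xi ->]]|[x1 ->]]
       [[j [j1 xj ->]]|[j [j1 xj ->]]|[z1 ->]] //.
all: try have := f_mid_lt_f_hi ha i1.
all: try have := f_mid_lt_f_hi ha j1.
all: try have := lowmid _ i1.
all: try have := lowmid _ j1.
all: try have := fup1 i.
all: try have := fup1 j.
all: move=> *; try (exfalso; lra).
all: have eij : i = j by apply: (@f_index_uniq R alpha x) => //; lra.
all: subst j => //; exfalso; lra.
Qed.

Definition kappa (R : realType) (alpha : R) (k : nat) (u : k.-tuple bool) : R :=
  (1 - alpha) * \sum_(i < k) (tnth u i : nat)%:R * alpha ^+ i.

Definition I_alpha (R : realType) (alpha : R) (k : nat)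
    (u : k.-tuple bool) : set R :=
  `[kappa alpha u, kappa alpha u + alpha ^+ k].

(* A Borel probability measure on [0, 1] is encoded as one on the line giving
   full mass to [0, 1]. *)
Definition is_mu_alpha (R : realType) (alpha : R)
    (mu : probability (measurableTypeR R) R) : Prop :=
  mu `[0, 1]%classic = 1%E /\
  forall (k : nat) (u : k.-tuple bool), (1 <= k)%N ->
    mu (I_alpha alpha u) = ((2 ^+ k)^-1)%:E.

(* The indices 0 <= i < l, where [None] stands for l = +oo. *)
Definition below (l : option nat) : set nat :=
  [set i | if l is Some m then (i < m)%N else true].

(* On [0, 1] with l >= 1 this is the supremum of a nonempty bounded set. *)
Definition rho (R : realType) (f : R -> R) (l : option nat) (x y : R) : R :=
  sup [set `|iter i f x - iter i f y| | i in below l].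

Definition corr_sum (R : realType) (f : R -> R) (l : option nat)
    (x : R) (n : nat) (r : R) : R :=
  #|[pred p : 'I_n * 'I_n |
       rho f l (iter p.1 f x) (iter p.2 f x) <= r]|%:R / n%:R ^+ 2.

Definition corr_integral (R : realType) (f : R -> R)
    (mu : probability (measurableTypeR R) R) (l : option nat) (r : R) : R :=
  fine ((mu \x mu)%E
    [set p : measurableTypeR R * measurableTypeR R |
       [/\ p.1 \in `[0, 1], p.2 \in `[0, 1] & rho f l p.1 p.2 <= r]]).

(* Main.v *)
Require Import Defs.
From HB Require Import structures.
From mathcomp Require Import all_boot all_order all_algebra.
From mathcomp Require Import all_classical all_reals all_analysis.
From mathcomp Require Import measurable_realfun.
From mathcomp Require Import ring lra zify.

(**
On the binary expansions of points, [f_alpha] is the 2-adic odometer: it maps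
the level-[m] interval whose digits are those of [n] into the one of [n + 1].
Hence, up to an error [alpha ^ m], both the orbit of 0 and the distances along
joint orbits only depend on residues mod [2 ^ m]. This squeezes the limit
points of the correlation sum and the correlation integral between the
proportions of the pairs of residues at distance at most [r - alpha ^ m] and at
most [r + alpha ^ m]. The two proportions differ by O(2 ^ -m): since
[alpha < 1/2], distinct level-[m] points are more than [alpha ^ m] apart, so
for each residue [j] only boundedly many residues [i] have a distance that
falls in the window around [r].
*)

Set Implicit Arguments.
Unset Strict Implicit.
Unset Printing Implicit Defensive.

Import Order.TTheory GRing.Theory Num.Theory.
Import numFieldNormedType.Exports.

Local Open Scope classical_set_scope.
Local Open Scope ring_scope.

(** * The odometer *)

Lemma f_alphaE (R : realType) (alpha x y : R) (ha : 0 < alpha < 1 / 2) :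
  f_graph alpha x y -> f_alpha alpha x = y.
Proof.
move=> gxy; apply: (f_graph_uniq ha _ gxy).
by rewrite /f_alpha; case: xgetP => // /(_ y).
Qed.

Lemma f_alphaP (R : realType) (alpha x : R) (ha : 0 < alpha < 1 / 2) :
  0 <= x <= 1 -> f_graph alpha x (f_alpha alpha x).
Proof.
by move=> hx; have [y gxy] := f_graph_ex ha hx; rewrite (f_alphaE ha gxy).
Qed.

Lemma f_alpha_itv (R : realType) (alpha x : R) (ha : 0 < alpha < 1 / 2) :
  0 <= x <= 1 -> 0 <= f_alpha alpha x <= 1.
Proof.
move=> hx; case: (f_alphaP ha hx) => [[[|j] []// _]|[[|j] []// _]|[_ ->]].
- rewrite /f_lo /f_mid /= exprS => hj ->.
  set p := alpha ^+ j in hj *.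
  have p0 : 0 < p by apply: exprn_gt0; lra.
  have p1 : p <= 1 by apply: exprn_ile1; lra.
  have : alpha * p <= p * 1 by rewrite mulrC ler_wpM2l//; lra.
  lra.
- rewrite /f_mid /f_hi /= !exprS => hj ->.
  set p := alpha ^+ j in hj *.
  have p0 : 0 < p by apply: exprn_gt0; lra.
  have p1 : p <= 1 by apply: exprn_ile1; lra.
  have d0 : 0 < 1 - 2 * alpha by lra.
  set y := (Y in 0 <= Y <= 1).
  (* Since [2 * alpha - 1] is negative, this branch decreases. Over a positive denominator both
     bounds become polynomial; the end values are [p] on the left and [alpha * (1 - alpha) * p] on
     the right. *)
  have ey : y = ((1 - alpha + alpha ^+ 2) * (1 - x)
                 - alpha ^+ 2 * p * (2 - alpha)) / (1 - 2 * alpha).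
    rewrite /y; field; lra.
  have A0 : 0 < 1 - alpha + alpha ^+ 2 by have := sqr_ge0 alpha; lra.
  have lo : 0 <= (1 - alpha + alpha ^+ 2) * ((1 - x) - alpha * p).
    by apply: mulr_ge0; lra.
  have hi : 0 <= (1 - alpha + alpha ^+ 2) * (p - alpha * p - (1 - x)).
    by apply: mulr_ge0; lra.
  rewrite ey ler_pdivlMr// ler_pdivrMr// mul0r mul1r.
  have q0 : 0 <= p * (1 - 2 * alpha) * alpha * (1 - alpha).
    by repeat (apply: mulr_ge0; try lra).
  have q1 : 0 <= (1 - p) * (1 - 2 * alpha) by apply: mulr_ge0; lra.
  by apply/andP; split; lra.
- lra.
Qed.

(** Multiplication by [alpha] prepends the digit 0. Piece [j = 1] of the map is the translation by
    [1 - alpha], which turns this digit into 1 without a carry. *)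
Lemma f_alpha_digit0 (R : realType) (alpha x : R) (ha : 0 < alpha < 1 / 2) :
  0 <= x <= 1 -> f_alpha alpha (alpha * x) = 1 - alpha + alpha * x.
Proof.
move=> hx; apply: f_alphaE => //; apply: Or31; exists 1%N.
rewrite /f_lo /f_mid /= expr0 expr1; split => //; last by ring.
have h1 : 0 <= alpha * x by apply: mulr_ge0; lra.
have h2 : 0 <= alpha * (1 - x) by apply: mulr_ge0; lra.
by apply/andP; split; lra.
Qed.

(** The carry rule: prepending the digit 1 sends piece [j] of the map to piece [j.+1], fixes the
    point 1 and scales the values by [alpha]. *)
Lemma f_alpha_digit1 (R : realType) (alpha x : R) (ha : 0 < alpha < 1 / 2) :
  0 <= x <= 1 ->
  f_alpha alpha (1 - alpha + alpha * x) = alpha * f_alpha alpha x.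
Proof.
move=> hx; apply: f_alphaE => //.
have a0 : 0 < alpha by lra.
case: (f_alphaP ha hx) => [[[|j] []// _ hj ->]|[[|j] []// _ hj ->]|[-> ->]].
- apply: Or31; exists j.+2; move: hj; rewrite /f_lo /f_mid /= => hj; split => //.
    have h1 : 0 <= alpha * (x - (1 - alpha ^+ j)) by apply: mulr_ge0; lra.
    have h2 : 0 <= alpha * (1 - alpha ^+ j + alpha ^+ j.+1 - x) by apply: mulr_ge0; lra.
    move: h1 h2; rewrite !exprS => h1 h2; apply/andP; split; lra.
  by rewrite !exprS; ring.
- apply: Or32; exists j.+2; move: hj; rewrite /f_mid /f_hi /= => hj; split => //.
    have h1 : 0 < alpha * (x - (1 - alpha ^+ j + alpha ^+ j.+1)) by apply: mulr_gt0; lra.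
    have h2 : 0 < alpha * (1 - alpha ^+ j.+1 - x) by apply: mulr_gt0; lra.
    move: h1 h2; rewrite !exprS => h1 h2; apply/andP; split; lra.
  by rewrite !exprS; ring.
- by apply: Or33; split; ring.
Qed.

(* The point of the level-[m] skeleton of the Cantor set whose digits are the
   [m] lowest binary digits of [n]; adding 1 to [n] is the odometer. *)
Fixpoint kap (R : realType) (alpha : R) (m n : nat) : R :=
  if m is m'.+1 then (1 - alpha) * (odd n)%:R + alpha * kap alpha m' n./2
  else 0.

Lemma kap_0 (R : realType) (alpha : R) (m : nat) : kap alpha m 0 = 0.
Proof. by elim: m => //= m ->; rewrite !mulr0 addr0. Qed.

Lemma kap_itv (R : realType) (alpha : R) (m n : nat) (ha : 0 < alpha < 1 / 2) :
  0 <= kap alpha m n <= 1 - alpha ^+ m.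
Proof.
elim: m n => [|m IH] n /=; first by rewrite expr0 subrr lexx.
have {IH} /andP[h1 h2] := IH n./2.
have k1 : 0 <= alpha * kap alpha m n./2 by apply: mulr_ge0; lra.
have k2 : 0 <= alpha * (1 - alpha ^+ m - kap alpha m n./2) by apply: mulr_ge0; lra.
by rewrite exprS; case: (odd n) => /=; apply/andP; split; lra.
Qed.

Lemma kap_addM (R : realType) (alpha : R) (m n k : nat) :
  kap alpha m (n + k * 2 ^ m) = kap alpha m n.
Proof.
elim: m n k => [//|m IH] n k /=.
have -> : (n + k * 2 ^ m.+1)./2 = (n./2 + k * 2 ^ m)%N.
  by rewrite expnS mulnCA mul2n halfD odd_double andbF doubleK.
by rewrite IH expnS mulnCA mul2n oddD odd_double addbF.
Qed.

Lemma kap_mod (R : realType) (alpha : R) (m n : nat) :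
  kap alpha m (n %% 2 ^ m) = kap alpha m n.
Proof. by rewrite [in RHS](divn_eq n (2 ^ m)) addnC kap_addM. Qed.

(** By induction on the first differing digit. At level [m.+1], unequal lowest digits put the points
    at distance at least [1 - 2 * alpha + alpha ^+ m.+1], where [alpha < 1 / 2] gives strictness;
    equal lowest digits scale the distance of the tails by [alpha]. *)
Lemma kap_sub_gt (R : realType) (alpha : R) (m a b : nat)
    (ha : 0 < alpha < 1 / 2) :
  a != b %[mod 2 ^ m] -> alpha ^+ m < `|kap alpha m a - kap alpha m b|.
Proof.
rewrite -(kap_mod _ _ a) -(kap_mod _ _ b).
have := ltn_pmod a (expn_gt0 2 m); have := ltn_pmod b (expn_gt0 2 m).
move: (a %% _)%N (b %% _)%N => {}a {}b.
elim: m a b => [|m IH] a b; first by rewrite expn0 !ltnS !leqn0 => /eqP-> /eqP->.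
rewrite expnS => hb hq neq /=.
have [e|] := boolP (odd a == odd b); last first.
  have /andP[h1 h2] := kap_itv m a./2 ha.
  have /andP[h3 h4] := kap_itv m b./2 ha.
  set u := kap _ _ _ in h1 h2 *; set v := kap _ _ _ in h3 h4 *.
  have k1 : 0 <= alpha * u by apply: mulr_ge0; lra.
  have k2 : 0 <= alpha * (1 - alpha ^+ m - u) by apply: mulr_ge0; lra.
  have k3 : 0 <= alpha * v by apply: mulr_ge0; lra.
  have k4 : 0 <= alpha * (1 - alpha ^+ m - v) by apply: mulr_ge0; lra.
  have k5 : 0 <= alpha * alpha ^+ m by apply: mulr_ge0; rewrite ?exprn_ge0; lra.
  rewrite exprS; case: (odd a); case: (odd b) => //= _.
    by rewrite ger0_norm; lra.
  by rewrite ler0_norm; lra.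
rewrite (eqP e).
set c := (1 - alpha) * _.
rewrite [X in `|X|](_ : _ = alpha * (kap alpha m a./2 - kap alpha m b./2)); last by ring.
rewrite normrM gtr0_norm ?exprS ?ltr_pM2l; try lra.
apply: IH; [lia|lia|].
by move: neq; rewrite -(odd_double_half a) -(odd_double_half b) (eqP e); lia.
Qed.

Lemma kap_le_eqmod (R : realType) (alpha : R) (m a b : nat)
    (ha : 0 < alpha < 1 / 2) :
  `|kap alpha m a - kap alpha m b| <= alpha ^+ m -> a = b %[mod 2 ^ m].
Proof.
by move=> h; apply/eqP; apply: contraLR h => /(kap_sub_gt ha); rewrite ltNge.
Qed.

(* A carry replaces two digits of weight [alpha ^ i] by one of the smaller
   weight [alpha ^ i.+1]. *)
Lemma kap_subadd (R : realType) (alpha : R) (m a b : nat)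
    (ha : 0 < alpha < 1 / 2) :
  kap alpha m (a + b) <= kap alpha m a + kap alpha m b.
Proof.
elim: m a b => [|m IH] a b /=; first by rewrite addr0.
have a0 : 0 < alpha by lra.
rewrite halfD oddD.
case: (odd a); case: (odd b); rewrite /= ?addn0 ?add0n.
- have h1 : kap alpha m 1 <= 1 - alpha.
    case: m {IH} => [|m] /=; first by lra.
    by rewrite kap_0; lra.
  have e1 := IH a./2 (b./2 + 1)%N; have e2 := IH b./2 1%N.
  rewrite addnA addnC in e1.
  have : 0 <= alpha * (kap alpha m a./2 + (kap alpha m b./2 + (1 - alpha))
                       - kap alpha m (1 + (a./2 + b./2))).
    by apply: mulr_ge0; lra.
  have : 0 <= (1 - alpha) * (2 - alpha) by apply: mulr_ge0; lra.
  lra.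
all: have := IH a./2 b./2; rewrite -(ler_pM2l a0); lra.
Qed.

(** Addition of 1 digit by digit: a leading 0 becomes 1 and the tail stays, a leading 1 becomes 0
    and the carry acts on the tail. A carry past the last digit is lost, since [kap] only sees
    residues mod [2 ^ m]. *)
Lemma f_alpha_kap (R : realType) (alpha x : R) (m n : nat)
    (ha : 0 < alpha < 1 / 2) :
  kap alpha m n <= x <= kap alpha m n + alpha ^+ m ->
  kap alpha m n.+1 <= f_alpha alpha x <= kap alpha m n.+1 + alpha ^+ m.
Proof.
have a0 : 0 < alpha by lra.
elim: m n x => [|m IH] n x; first by rewrite /= !add0r; exact: f_alpha_itv.
rewrite /= exprS => hx.
have /andP[k1 k2] := kap_itv m n./2 ha.
(* [y] is [x] with its leading digit removed. *)
pose y := (x - (1 - alpha) * (odd n)%:R) / alpha.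
have ex : x = (1 - alpha) * (odd n)%:R + alpha * y by rewrite /y; field; lra.
have hy : kap alpha m n./2 <= y <= kap alpha m n./2 + alpha ^+ m.
  by move: hx; rewrite ex -addrA -mulrDr !lerD2l !ler_pM2l.
have hy01 : 0 <= y <= 1 by lra.
rewrite ex uphalf_half; case: (odd n) => /=; rewrite ?mulr0n ?mulr1n ?mulr0 ?mulr1 ?add0r.
  have := IH n./2 y hy; rewrite f_alpha_digit1// -add1n => h.
  by rewrite -(mulrDr alpha) !ler_pM2l.
by rewrite f_alpha_digit0// add0n -!addrA -(mulrDr alpha) !lerD2l !ler_pM2l.
Qed.

Lemma iter_f_alpha_kap (R : realType) (alpha x : R) (m n i : nat)
    (ha : 0 < alpha < 1 / 2) :
  kap alpha m n <= x <= kap alpha m n + alpha ^+ m ->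
  kap alpha m (n + i) <= iter i (f_alpha alpha) x
    <= kap alpha m (n + i) + alpha ^+ m.
Proof.
move=> hx; elim: i => [|i IH] /=; first by rewrite addn0.
by rewrite addnS; exact: f_alpha_kap.
Qed.

(** * Counting pairs *)

(** The relation lives on [nat], so that it can be counted both over orbit times below [n] and over
    residues below [2 ^ m]. *)
Definition count_pairs (P : nat -> nat -> bool) (n : nat) : nat :=
  \sum_(i < n) \sum_(j < n) P i j.

Lemma card_count_pairs (P : nat -> nat -> bool) (n : nat) :
  #|[pred p : 'I_n * 'I_n | P p.1 p.2]| = count_pairs P n.
Proof.
rewrite /count_pairs pair_big -sum1_card big_mkcond /=.
by apply: eq_bigr => p _; rewrite inE; case: (P _ _).
Qed.

Lemma count_pairsC (P : nat -> nat -> bool) (n : nat) :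
  count_pairs (fun i j => P j i) n = count_pairs P n.
Proof. exact: exchange_big. Qed.

Lemma count_pairsS (P : nat -> nat -> bool) (n p : nat) :
  (n <= p)%N -> (count_pairs P n <= count_pairs P p)%N.
Proof.
have sub (F : nat -> nat) : (n <= p -> \sum_(i < n) F i <= \sum_(i < p) F i)%N.
  move=> np; rewrite -!(big_mkord xpredT F) [leqRHS](big_cat_nat (n := n))//=.
  exact: leq_addr.
move=> np; apply: leq_trans (sub (fun i => \sum_(j < p) P i j)%N np).
by apply: leq_sum => i _; exact: (sub (fun j => P i j : nat)).
Qed.

Lemma count_pairs_le (P Q : nat -> nat -> bool) (n : nat) :
  (forall i j, P i j -> Q i j) -> (count_pairs P n <= count_pairs Q n)%N.
Proof.
move=> PQ; apply: leq_sum => i _; apply: leq_sum => j _.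
by have := PQ i j; case: (P i j) => // ->.
Qed.

Lemma count_pairs_leD (P Q : nat -> nat -> bool) (n : nat) :
  (count_pairs P n <=
   count_pairs Q n + count_pairs (fun i j => P i j && ~~ Q i j) n)%N.
Proof.
rewrite -big_split /=; apply: leq_sum => i _.
rewrite -big_split /=; apply: leq_sum => j _.
by case: (P i j); case: (Q i j).
Qed.

Lemma count_pairs_sum (I : finType) (P : nat -> nat -> bool)
    (Q : I -> nat -> nat -> bool) (n K : nat) :
  (forall i j, (i < n)%N -> (j < n)%N -> P i j -> exists k, Q k i j) ->
  (forall k, count_pairs (Q k) n <= K)%N ->
  (count_pairs P n <= #|I| * K)%N.
Proof.
move=> PQ QK; apply: (@leq_trans (\sum_k count_pairs (Q k) n)); last first.
  by rewrite -sum_nat_const leq_sum.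
rewrite exchange_big /=; apply: leq_sum => i _.
rewrite exchange_big /=; apply: leq_sum => j _.
case Pij: (P i j) => //; have [k Qk] := PQ i j (ltn_ord i) (ltn_ord j) Pij.
by rewrite (bigD1 k)//= Qk.
Qed.

Lemma sum_periodic (F : nat -> nat) (N q : nat) :
  (forall i, F (i %% N)%N = F i) ->
  (\sum_(i < q * N) F i = q * \sum_(i < N) F i)%N.
Proof.
move=> FN; elim: q => [|q IH]; first by rewrite big_ord0.
rewrite mulSn -[LHS](big_mkord xpredT F) (big_cat_nat (n := N)) ?leq_addr//=.
rewrite big_mkord mulSn; congr addn.
rewrite -{1}(add0n N) big_addn addKn big_mkord -IH.
by apply: eq_bigr => i _; rewrite -FN modnDr FN.
Qed.

Lemma count_pairs_periodic (P : nat -> nat -> bool) (N q : nat) :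
  (forall i j, P (i %% N)%N j = P i j) -> (forall i j, P i (j %% N)%N = P i j) ->
  count_pairs P (q * N) = (q ^ 2 * count_pairs P N)%N.
Proof.
move=> P1 P2; rewrite /count_pairs.
rewrite (eq_bigr (fun i : 'I__ => q * \sum_(j < N) P i j)%N); last first.
  by move=> i _; apply: (sum_periodic (F := fun j => P i j : nat)) => j; rewrite P2.
rewrite (sum_periodic (F := fun i => q * \sum_(j < N) P i j)%N); last first.
  by move=> i; under eq_bigr do rewrite P1.
by rewrite -big_distrr /= mulnA.
Qed.

Lemma count_pairs_periodic_bounds (P : nat -> nat -> bool) (N n : nat) :
  (0 < N)%N ->
  (forall i j, P (i %% N)%N j = P i j) -> (forall i j, P i (j %% N)%N = P i j) ->
  ((n %/ N) ^ 2 * count_pairs P N <= count_pairs P n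
     <= (n %/ N).+1 ^ 2 * count_pairs P N)%N.
Proof.
move=> N0 P1 P2; rewrite -!count_pairs_periodic//.
by rewrite !count_pairsS// ?leq_divM// ltnW// ltn_ceil.
Qed.

(** With [q = n %/ N], the square of side [n] lies between those of sides [q * N] and [q.+1 * N],
    which consist of whole periods. The incomplete period costs a relative error of order
    [N / n]. *)
Lemma count_pairs_ratio (R : realType) (P : nat -> nat -> bool) (N n : nat) :
  (forall i j, P (i %% N)%N j = P i j) -> (forall i j, P i (j %% N)%N = P i j) ->
  (0 < N)%N -> (N <= n)%N ->
  (count_pairs P N)%:R / N%:R ^+ 2 - 3 * (N%:R / n%:R)
    <= ((count_pairs P n)%:R / n%:R ^+ 2 : R)
    <= (count_pairs P N)%:R / N%:R ^+ 2 + 3 * (N%:R / n%:R).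
Proof.
move=> P1 P2 N0 Nn.
have /andP[lo hi] := count_pairs_periodic_bounds n N0 P1 P2.
have cN : (count_pairs P N <= N ^ 2)%N.
  rewrite -card_count_pairs (leq_trans (max_card _))// card_prod card_ord.
  by rewrite expnS expn1.
have n0 : (0 : R) < n%:R by rewrite ltr0n (leq_trans N0).
have N0' : (0 : R) < N%:R by rewrite ltr0n.
have qn : (n %/ N)%:R * N%:R <= n%:R :> R by rewrite -natrM ler_nat leq_divM.
have nq : n%:R <= (n %/ N)%:R * N%:R + N%:R :> R.
  by rewrite -natrM -natrD ler_nat addnC -mulSn ltnW// ltn_ceil.
have := ler0n R (count_pairs P N); move: lo hi cN.
rewrite -!(ler_nat R) ![(_ * count_pairs P N)%:R]natrM !natrX -natr1.
move: (count_pairs P n)%:R (count_pairs P N)%:R => C c.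
set q := (n %/ N)%:R in qn nq *; move=> lo hi cN c0.
set a : R := n%:R in n0 qn nq *; set b : R := N%:R in N0' qn nq cN *.
have b2 : 0 < b ^+ 2 by rewrite exprn_gt0.
(* [t] is the relative size of one period, [x] the share of the complete periods and [p] the density
   over one period. *)
set t := b / a; set x := q * b / a; set p := c / b ^+ 2.
have t0 : 0 < t by rewrite divr_gt0.
have t1 : t <= 1 by rewrite ler_pdivrMr// mul1r ler_nat.
have x1 : x <= 1 by rewrite ler_pdivrMr// mul1r.
have xt : 1 <= x + t by rewrite -mulrDl ler_pdivlMr// mul1r.
have p1 : p <= 1 by rewrite ler_pdivrMr// mul1r.
have lo' : x ^+ 2 * p <= C / a ^+ 2.
  rewrite ler_pdivlMr ?exprn_gt0//.
  suff -> : x ^+ 2 * p * a ^+ 2 = q ^+ 2 * c by [].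
  by rewrite /x /p; field; rewrite !gt_eqF.
have hi' : C / a ^+ 2 <= (x + t) ^+ 2 * p.
  rewrite ler_pdivrMr ?exprn_gt0//.
  suff -> : (x + t) ^+ 2 * p * a ^+ 2 = (q + 1) ^+ 2 * c by [].
  by rewrite /x /t /p; field; rewrite !gt_eqF.
have p0 : 0 <= p by rewrite divr_ge0// ltW.
have x0 : 0 <= x by rewrite divr_ge0 ?mulr_ge0 ?ler0n.
(* [(x + t) ^ 2 <= (1 + t) ^ 2 <= 1 + 3 t] and [x ^ 2 >= (1 - t) ^ 2 >= 1 - 2 t] *)
have h1 : 0 <= p * ((1 - x) * (1 + x + 2 * t)).
  by apply: (mulr_ge0 p0); apply: mulr_ge0; lra.
have h2 : 0 <= p * (t * (1 - t)).
  by apply: (mulr_ge0 p0); apply: mulr_ge0; lra.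
have h3 : 0 <= (1 - p) * t by apply: mulr_ge0; lra.
have h4 : 0 <= p * ((x - (1 - t)) * (x + (1 - t))).
  by apply: (mulr_ge0 p0); apply: mulr_ge0; lra.
have h5 : 0 <= p * t ^+ 2 by rewrite mulr_ge0 ?sqr_ge0.
by apply/andP; split; lra.
Qed.

(** * The boundary of the correlation set *)

(** The window has length [2 * alpha ^+ m] and distinct points are more than [alpha ^+ m] apart.
    Cutting it into cells of length [alpha ^+ m] therefore leaves at most one point per cell. *)
Lemma card_kap_window (R : realType) (alpha s : R) (m c : nat)
    (ha : 0 < alpha < 1 / 2) :
  (\sum_(i < 2 ^ m) (`|kap alpha m (i + c) - s| <= alpha ^+ m)%R <= 3)%N.
Proof.
pose A := [set i : 'I_(2 ^ m) | `|kap alpha m (i + c) - s| <= alpha ^+ m]%SET.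
have -> : (\sum_(i < 2 ^ m) (`|kap alpha m (i + c) - s| <= alpha ^+ m)%R
          = #|A|)%N.
  rewrite -sum1_card [RHS]big_mkcond /=.
  by apply: eq_bigr => i _; rewrite inE; case: (_ <= _).
have d0 : 0 < alpha ^+ m by apply: exprn_gt0; lra.
pose v (i : 'I_(2 ^ m)) := (kap alpha m (i + c) - s) / alpha ^+ m + 1.
have vA i : i \in A -> 0 <= v i <= 2.
  rewrite inE ler_norml => /andP[h1 h2]; rewrite /v.
  rewrite -lerBlDr sub0r ler_pdivlMr// -lerBrDr ler_pdivrMr//.
  by apply/andP; split; lra.
(* The rescaled position lies in [[0, 2]], so its integer part takes three values, the value 2 only
   at the right end of the window. *)
pose g i : 'I_3 := inord (Num.truncn (v i)).
have gA i : i \in A -> (g i : nat)%:R <= v i < (g i).+1%:R.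
  move=> /vA /andP[v0 v2]; rewrite inordK; first exact: truncn_itv.
  by rewrite ltnS truncn_le_nat; lra.
suff gI : {in A &, injective g}.
  by rewrite -(card_in_imset gI) -[leqRHS]card_ord max_card.
move=> i j iA jA e; have := gA i iA; have := gA j jA.
rewrite e -natr1 => /andP[j1 j2] /andP[i1 i2].
have : `|v i - v j| <= 1 by rewrite ler_norml; apply/andP; split; lra.
have -> : v i - v j = (kap alpha m (i + c) - kap alpha m (j + c)) / alpha ^+ m.
  by rewrite /v; field; rewrite gt_eqF.
rewrite normrM normfV (gtr0_norm d0) ler_pdivrMr// mul1r => /(kap_le_eqmod ha)/eqP.
by rewrite eqn_modDr !modn_small// => /eqP/val_inj.
Qed.

Lemma count_pairs_kap_window (R : realType) (alpha : R) (s : nat -> R) (m : nat)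
    (c : nat -> nat) (ha : 0 < alpha < 1 / 2) :
  (count_pairs (fun i j => `|kap alpha m (i + c j) - s j| <= alpha ^+ m)%R
     (2 ^ m) <= 2 ^ m * 3)%N.
Proof.
rewrite -count_pairsC -[X in (_ <= X * _)%N]card_ord -sum_nat_const.
by apply: leq_sum => j _; exact: card_kap_window.
Qed.

(** The counterpart of [rho <= t] on residues, with a quantifier over times in place of a supremum;
    [l] may be infinite, whence the classical truth value. *)
Definition kap_near (R : realType) (alpha : R) (l : option nat) (m : nat) (t : R)
    (i j : nat) : bool :=
  `[< forall k, below l k ->
      `|kap alpha m (i + k) - kap alpha m (j + k)| <= t >].

Lemma kap_near_modl (R : realType) (alpha t : R) l (m i j : nat) :
  kap_near alpha l m t (i %% 2 ^ m) j = kap_near alpha l m t i j.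
Proof.
apply: asbool_equiv_eq; split=> h k /h;
by rewrite -(kap_mod _ _ (_ %% _ + _)) modnDml kap_mod.
Qed.

Lemma kap_near_modr (R : realType) (alpha t : R) l (m i j : nat) :
  kap_near alpha l m t i (j %% 2 ^ m) = kap_near alpha l m t i j.
Proof.
apply: asbool_equiv_eq; split=> h k /h;
by rewrite -(kap_mod _ _ (_ %% _ + _)) modnDml kap_mod.
Qed.

(* For a finite horizon one of the finitely many distances lies in the window
   around [r]. For the infinite horizon, subadditivity of [kap] shows that the
   supremum over the joint orbit is [max (kap (i - j)) (kap (j - i))], so one of
   these two numbers lies in the window. *)
Lemma count_pairs_kap_near_boundary (R : realType) (alpha r : R) (l : option nat)
    (ha : 0 < alpha < 1 / 2) :
  exists K, forall m, (count_pairs (fun i j =>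
      kap_near alpha l m (r + alpha ^+ m)%R i j
      && ~~ kap_near alpha l m (r - alpha ^+ m)%R i j) (2 ^ m) <= K * 2 ^ m)%N.
Proof.
case: l => [l|].
  exists (#|{: 'I_l * bool}| * 3)%N => m.
  pose Q0 (k : 'I_l) i j :=
    `|kap alpha m (i + k) - (kap alpha m (j + k) + r)| <= alpha ^+ m.
  (* The index records the time at which the distance exceeds [r - alpha ^+ m] and the sign of the
     difference there. *)
  pose Q (p : 'I_l * bool) i j := if p.2 then Q0 p.1 i j else Q0 p.1 j i.
  rewrite -mulnA (mulnC 3%N); apply: (@count_pairs_sum _ _ Q).
  - move=> i j _ _ /andP[/asboolP h1 /asboolP/existsNP[k /not_implyP[kl /negP]]].
    rewrite -ltNge => h2; have := h1 k kl; move: h2.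
    have [s|s] := leP (kap alpha m (j + k)) (kap alpha m (i + k)).
      rewrite ger0_norm ?subr_ge0// => h2 h3.
      exists (Ordinal kl, true); rewrite /Q /Q0 /= ler_norml.
      by apply/andP; split; lra.
    rewrite ltr0_norm ?subr_lt0// => h2 h3.
    exists (Ordinal kl, false); rewrite /Q /Q0 /= ler_norml.
    by apply/andP; split; lra.
  - have QK k : (count_pairs (Q0 k) (2 ^ m) <= 2 ^ m * 3)%N.
      exact: (count_pairs_kap_window (fun j => kap alpha m (j + k) + r) m
               (fun=> k : nat) ha).
    by move=> [k []]; rewrite /Q /=; last rewrite (count_pairsC (Q0 k)).
exists (#|{: bool}| * 3)%N => m.
(* [2 ^ m - j] represents [- j] mod [2 ^ m], so that this is a condition on [kap (i - j)]. *)
pose Q0 i j := `|kap alpha m (i + (2 ^ m - j)) - r| <= alpha ^+ m.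
pose Q (b : bool) i j := if b then Q0 i j else Q0 j i.
rewrite -mulnA (mulnC 3%N); apply: (@count_pairs_sum _ _ Q); last first.
  have QK : (count_pairs Q0 (2 ^ m) <= 2 ^ m * 3)%N.
    exact: (count_pairs_kap_window (fun=> r) m (fun j => 2 ^ m - j)%N ha).
  by move=> [|]; rewrite /Q /=; last rewrite (count_pairsC Q0).
have kap0 : kap alpha m (2 ^ m) = 0.
  by rewrite -[(2 ^ m)%N]mul1n -[(1 * _)%N]add0n kap_addM kap_0.
(* Modulo [2 ^ m], [i + k] is the sum of [j + k] and [i - j]; subadditivity then bounds the signed
   difference at every time by [kap (i - j)]. *)
have sub i j k : (j < 2 ^ m)%N -> kap alpha m (i + k) <=
    kap alpha m (j + k) + kap alpha m (i + (2 ^ m - j)).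
  move=> hj; rewrite -(kap_addM _ _ (i + k) 1) mul1n.
  have -> : (i + k + 2 ^ m = j + k + (i + (2 ^ m - j)))%N by lia.
  exact: kap_subadd.
move=> i j hi hj /andP[/asboolP h1 /asboolP/existsNP[k /not_implyP[kl /negP]]].
(* At time [2 ^ m - j] the second point has returned to 0, so the distance there is [kap (i - j)];
   hence this number is at most [r + alpha ^+ m]. Symmetrically for [kap (j - i)]. *)
have ij := h1 (2 ^ m - j)%N isT; have ji := h1 (2 ^ m - i)%N isT.
rewrite subnKC ?(ltnW hj)// kap0 subr0 in ij.
rewrite [(i + _)%N]subnKC ?(ltnW hi)// kap0 sub0r normrN in ji.
rewrite !ger0_norm in ij ji; last 2 first.
- by have := kap_itv m (j + (2 ^ m - i)) ha; lra.
- by have := kap_itv m (i + (2 ^ m - j)) ha; lra.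
rewrite -ltNge => h2.
have s1 := sub i j k hj; have s2 := sub j i k hi.
have [s|s] := leP (kap alpha m (j + k)) (kap alpha m (i + k)).
  rewrite ger0_norm ?subr_ge0// in h2.
  by exists true; rewrite /Q /Q0 /= ler_norml; apply/andP; split; lra.
rewrite ltr0_norm ?subr_lt0// in h2.
by exists false; rewrite /Q /Q0 /= ler_norml; apply/andP; split; lra.
Qed.

(** * Measures of unions of rectangles *)

Lemma measurable_f_alpha (R : realType) (alpha : R) (ha : 0 < alpha < 1 / 2) :
  measurable_fun setT (f_alpha alpha : measurableTypeR R -> measurableTypeR R).
Proof.
(* The half-open pieces cover [[0, 1)] and carry two affine branches each. On the remaining set
   [E 0] the map is constantly 0: by definition at 1, by the default value outside [[0, 1]]. *)
pose E (n : nat) : set (measurableTypeR R) :=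
  if n is j.+1 then `[f_lo alpha j.+1, f_hi alpha j.+1[%classic
  else ~` `[0, 1[%classic.
have E01 j x : x \in `[f_lo alpha j.+1, f_hi alpha j.+1[ -> 0 <= x < 1.
  rewrite in_itv /= /f_lo /f_hi /= => /andP[h1 h2].
  have p1 : 0 < alpha ^+ j.+1 by apply: exprn_gt0; lra.
  have p2 : alpha ^+ j <= 1 by apply: exprn_ile1; lra.
  by apply/andP; split; lra.
have cov : [set: measurableTypeR R] = \bigcup_n E n.
  apply/esym/seteqP; split=> // x _.
  have [hx|hx] := boolP (0 <= x < 1); last first.
    by exists 0%N => //=; rewrite in_itv /=; exact/negP.
  have hx1 : 0 <= x <= 1 by lra.
  case: (f_alphaP ha hx1) => [[[|j] [// _ hj _]]|[[|j] [// _ hj _]]|[x1 _]].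
  - exists j.+1 => //=; rewrite in_itv /=.
    by have := f_mid_lt_f_hi ha (ltn0Sn j); lra.
  - exists j.+1 => //=; rewrite in_itv /=.
    have : 0 < alpha ^+ j.+1 by apply: exprn_gt0; lra.
    by move: hj; rewrite /f_lo /f_mid /=; lra.
  - lra.
rewrite cov; apply/measurable_fun_bigcup.
  by case=> [|j] /=; [apply: measurableC|]; exact: measurable_itv.
case=> [|j].
  apply: (eq_measurable_fun
    (cst (0 : R) : measurableTypeR R -> measurableTypeR R));
    last exact: measurable_cst.
  move=> x; rewrite inE /= in_itv /= => x01; apply/esym.
  have [->|x1] := eqVneq x 1; first by apply: f_alphaE => //; exact: Or33.
  rewrite /f_alpha; apply: xgetPN => y.
  case=> [[[|j] [// _ hj _]]|[[|j] [// _ hj _]]|[xx1 _]].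
  - apply: x01; apply: (E01 j); rewrite in_itv /=.
    by have := f_mid_lt_f_hi ha (ltn0Sn j); lra.
  - apply: x01; apply: (E01 j); rewrite in_itv /=.
    have : 0 < alpha ^+ j.+1 by apply: exprn_gt0; lra.
    by move: hj; rewrite /f_lo /f_mid /=; lra.
  - by move: x1; rewrite xx1 eqxx.
apply: (eq_measurable_fun (fun x : measurableTypeR R =>
  if x <= f_mid alpha j.+1 then x - 1 + 2 * alpha ^+ j - alpha ^+ j.+1
  else (1 - alpha + alpha ^+ 2) / (2 * alpha - 1) * (x - 1)
            + alpha ^+ j.+2 * ((2 - alpha) / (2 * alpha - 1)))).
  move=> x; rewrite inE /= in_itv /= => /andP[x1 x2]; apply/esym/f_alphaE => //.
  case: leP => h; [apply: Or31|apply: Or32]; exists j.+1; split=> //.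
    by rewrite x1.
  by rewrite h.
apply: measurable_funTS; apply: measurable_fun_ifT.
- exact: measurable_fun_ler.
- by do ! (apply: measurable_funB || apply: measurable_funD).
- apply: measurable_funD => //; apply: measurable_funM => //.
  exact: measurable_funB.
Qed.

Lemma iter_f_alpha_itv (R : realType) (alpha x : R) (i : nat)
    (ha : 0 < alpha < 1 / 2) :
  0 <= x <= 1 -> 0 <= iter i (f_alpha alpha) x <= 1.
Proof. by move=> hx; elim: i => //= i; exact: f_alpha_itv. Qed.

(** Trades the supremum for a quantifier. The set of distances is bounded because orbits stay in
    [[0, 1]], and nonempty because [hl] admits the time 0. *)
Lemma rho_f_alpha_le (R : realType) (alpha x y r : R) (l : option nat)
    (ha : 0 < alpha < 1 / 2) (hl : if l is Some m then (1 <= m)%N else true) :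
  0 <= x <= 1 -> 0 <= y <= 1 ->
  rho (f_alpha alpha) l x y <= r <->
  forall i, below l i ->
    `|iter i (f_alpha alpha) x - iter i (f_alpha alpha) y| <= r.
Proof.
move=> hx hy; split=> [h i il|h].
  apply: le_trans h; apply: ub_le_sup; last by exists i.
  exists 1 => _ [j _ <-]; rewrite ler_norml.
  have := iter_f_alpha_itv j ha hx; have := iter_f_alpha_itv j ha hy.
  by move=> *; apply/andP; split; lra.
apply: ge_sup; last by move=> _ [i il <-]; exact: h.
by apply: image_nonempty; exists 0%N; case: l hl {h}.
Qed.

(** The set is a countable intersection, over the times, of measurable conditions on the
    iterates. *)
Lemma measurable_rho_f_alpha (R : realType) (alpha r : R) (l : option nat)
    (ha : 0 < alpha < 1 / 2) (hl : if l is Some m then (1 <= m)%N else true) :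
  measurable [set p : measurableTypeR R * measurableTypeR R |
    [/\ p.1 \in `[0, 1], p.2 \in `[0, 1] & rho (f_alpha alpha) l p.1 p.2 <= r]].
Proof.
have mf i : measurable_fun setT
    (iter i (f_alpha alpha) : measurableTypeR R -> measurableTypeR R).
  elim: i => [|i IH]; first exact: measurable_id.
  exact: measurableT_comp (measurable_f_alpha ha) IH.
pose T := (measurableTypeR R * measurableTypeR R)%type.
pose F i : set T := [set p : T |
  `|iter i (f_alpha alpha) p.1 - iter i (f_alpha alpha) p.2| <= r].
rewrite [X in measurable X](_ : _ =
    (`[0, 1]%classic `*` `[0, 1]%classic) `&` \bigcap_(i in below l) F i).
  apply: measurableI.
    by apply: measurableX; exact: measurable_itv.
  apply: bigcap_measurable => [|i _]; first by exists 0%N; case: l hl.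
  rewrite /F -[X in measurable X]setTI.
  apply: (measurable_fun_le (f := fun p : T => _) (g := fun=> r)) => //.
  apply: measurableT_comp; first exact: normr_measurable.
  by apply: measurable_funB; apply: measurableT_comp (mf i) _.
apply/seteqP; split=> [p /= [h1 h2 h]|p /= [[h1 h2] h]].
  split => //; apply/(rho_f_alpha_le r ha hl) => //.
by split => //; apply/(rho_f_alpha_le r ha hl).
Qed.

Definition kap_itv_set (R : realType) (alpha : R) (m n : nat) :
    set (measurableTypeR R) :=
  `[kap alpha m n, kap alpha m n + alpha ^+ m]%classic.

(** Words list the digits from the lowest bit upwards; this identifies the intervals indexed by
    integers with the cylinders [I_alpha] whose measure is prescribed. *)
Lemma kappaE (R : realType) (alpha : R) (m n : nat) :
  kappa alpha [tuple odd (n %/ 2 ^ i) | i < m] = kap alpha m n.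
Proof.
rewrite /kappa; under eq_bigr do rewrite tnth_mktuple.
elim: m n => [|m IH] n; first by rewrite big_ord0 mulr0.
rewrite big_ord_recl /= divn1 expr0 mulr1 mulrDr; congr (_ + _).
rewrite -IH mulrCA; congr (_ * _); rewrite big_distrr /=.
apply: eq_bigr => i _; rewrite /bump /= add1n exprS mulrCA.
by rewrite expnS divnMA divn2.
Qed.

Lemma mu_kap_itv (R : realType) (alpha : R)
    (mu : probability (measurableTypeR R) R) (m n : nat) :
  is_mu_alpha alpha mu -> (0 < m)%N ->
  mu (kap_itv_set alpha m n) = ((2 ^+ m)^-1)%:E.
Proof.
move=> [_ hmu] m0; rewrite -(hmu _ [tuple odd (n %/ 2 ^ i) | i < m] m0).
by rewrite /I_alpha kappaE.
Qed.

(** Left ends of distinct level-[m] intervals are further apart than the length [alpha ^+ m], so the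
    rectangles are disjoint, and each has mass [(2 ^ m) ^- 2]. *)
Lemma prod_mu_kap_itv (R : realType) (alpha : R)
    (mu : probability (measurableTypeR R) R) (P : nat -> nat -> bool) (m : nat)
    (ha : 0 < alpha < 1 / 2) :
  is_mu_alpha alpha mu -> (0 < m)%N ->
  (mu \x mu)%E (\bigcup_(p in [set p : 'I_(2 ^ m) * 'I_(2 ^ m) | P p.1 p.2])
     (kap_itv_set alpha m p.1 `*` kap_itv_set alpha m p.2)) =
  ((count_pairs P (2 ^ m))%:R / (2 ^ m)%:R ^+ 2)%:E.
Proof.
move=> hmu m0.
have uniq i j (x : R) : kap_itv_set alpha m i x -> kap_itv_set alpha m j x ->
    i = j %[mod 2 ^ m].
  rewrite /kap_itv_set /= !in_itv /= => h1 h2.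
  by apply: (kap_le_eqmod ha); rewrite ler_norml; apply/andP; split; lra.
have mK n : measurable (kap_itv_set alpha m n) by exact: measurable_itv.
pose nu : {measure set (measurableTypeR R * measurableTypeR R) -> \bar R} :=
  (mu \x mu)%E.
rewrite [LHS](measure_fin_bigcup nu)//; last first.
- by move=> p _; exact: measurableX.
- move=> [i j] [i' j'] _ _ [[x y] [[/= ix jy] [/= ix' jy']]].
  have := uniq _ _ _ ix ix'; have := uniq _ _ _ jy jy'.
  by rewrite !modn_small// => /val_inj -> /val_inj ->.
- exact: finite_finset.
rewrite fsbig_finite; last exact: finite_finset.
rewrite (eq_bigr (fun=> (((2 ^ m)%:R ^+ 2)^-1)%:E)) /=; last first.
  move=> p _; rewrite natrX expr2 invfM EFinM -{1}(mu_kap_itv p.1 hmu m0).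
  by rewrite -(mu_kap_itv p.2 hmu m0); exact: product_measure1E.
rewrite sumEFin; congr _%:E.
rewrite (perm_big (enum [pred p : 'I_(2 ^ m) * 'I_(2 ^ m) | P p.1 p.2])) /=.
  by rewrite big_enum sumr_const card_count_pairs mulrC mulr_natr.
apply: uniq_perm; [exact: finmap.fset_uniq|exact: enum_uniq|].
move=> p; rewrite mem_enum in_fset_set ?inE//; last exact: finite_finset.
by rewrite mem_setE.
Qed.

(** * Squeezing correlation integral and sums between residue counts *)

Lemma kap_itv_set_itv (R : realType) (alpha x : R) (m n : nat)
    (ha : 0 < alpha < 1 / 2) :
  kap_itv_set alpha m n x ->
  kap alpha m n <= x <= kap alpha m n + alpha ^+ m /\ 0 <= x <= 1.
Proof.
rewrite /kap_itv_set /= in_itv /= => h; split=> //.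
by have := kap_itv m n ha; lra.
Qed.

(** Both iterates exceed their skeleton points by an amount in [[0, alpha ^+ m]], so the two errors
    differ by at most [alpha ^+ m], rather than adding up to twice that. *)
Lemma iter_kap_dist (R : realType) (alpha x y : R) (m i j k : nat)
    (ha : 0 < alpha < 1 / 2) :
  kap alpha m i <= x <= kap alpha m i + alpha ^+ m ->
  kap alpha m j <= y <= kap alpha m j + alpha ^+ m ->
  `| `|iter k (f_alpha alpha) x - iter k (f_alpha alpha) y|
     - `|kap alpha m (i + k) - kap alpha m (j + k)| | <= alpha ^+ m.
Proof.
move=> /(iter_f_alpha_kap k ha) hx /(iter_f_alpha_kap k ha) hy.
apply: le_trans (ler_dist_dist _ _) _; rewrite ler_norml.
by apply/andP; split; lra.
Qed.

Lemma rho_kap_near (R : realType) (alpha r x y : R) (l : option nat) (m i j : nat)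
    (ha : 0 < alpha < 1 / 2) (hl : if l is Some m then (1 <= m)%N else true) :
  0 <= x <= 1 -> 0 <= y <= 1 ->
  kap alpha m i <= x <= kap alpha m i + alpha ^+ m ->
  kap alpha m j <= y <= kap alpha m j + alpha ^+ m ->
  (kap_near alpha l m (r - alpha ^+ m) i j ->
     rho (f_alpha alpha) l x y <= r) /\
  (rho (f_alpha alpha) l x y <= r ->
     kap_near alpha l m (r + alpha ^+ m) i j).
Proof.
move=> x01 y01 hx hy; split=> [/asboolP h|].
  apply/(rho_f_alpha_le r ha hl) => // k kl.
  have := iter_kap_dist k ha hx hy; rewrite ler_norml => /andP[_].
  by have := h k kl; lra.
move=> /(rho_f_alpha_le r ha hl x01 y01) h; apply/asboolP => k kl.
have := iter_kap_dist k ha hx hy; rewrite ler_norml => /andP[+ _].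
by have := h k kl; lra.
Qed.

Lemma corr_integral_bounds (R : realType) (alpha r : R) (l : option nat)
    (mu : probability (measurableTypeR R) R) (m : nat)
    (ha : 0 < alpha < 1 / 2) (hl : if l is Some m then (1 <= m)%N else true) :
  is_mu_alpha alpha mu -> (0 < m)%N ->
  (count_pairs (kap_near alpha l m (r - alpha ^+ m)) (2 ^ m))%:R
     / (2 ^ m)%:R ^+ 2
   <= corr_integral (f_alpha alpha) mu l r
   <= (count_pairs (kap_near alpha l m (r + alpha ^+ m)) (2 ^ m))%:R
     / (2 ^ m)%:R ^+ 2.
Proof.
move=> hmu m0; rewrite /corr_integral.
set A := [set p | _].
have mA : measurable A by exact: measurable_rho_f_alpha.
pose nu : {measure set (measurableTypeR R * measurableTypeR R) -> \bar R} :=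
  (mu \x mu)%E.
have nuT : nu setT = 1%E.
  rewrite -setXTT; apply: etrans (product_measure1E _ _ _ _) _ => //.
  by rewrite -[X in (X * _)%E]/(mu setT) probability_setT mul1e;
    exact: probability_setT.
pose U (P : nat -> nat -> bool) :=
  \bigcup_(p in [set p : 'I_(2 ^ m) * 'I_(2 ^ m) | P p.1 p.2])
     (kap_itv_set alpha m p.1 `*` kap_itv_set alpha m p.2).
have mU P : measurable (U P).
  apply: fin_bigcup_measurable; first exact: finite_finset.
  by move=> p _; apply: measurableX; exact: measurable_itv.
have nuU P : nu (U P) = _ := prod_mu_kap_itv P ha hmu m0.
have nu_fin B : measurable B -> nu B \is a fin_num.
  move=> mB; rewrite ge0_fin_numE//; apply: le_lt_trans (ltry 1).
  by rewrite -nuT; apply: le_measure; rewrite ?inE.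
rewrite -/(nu A).
have N0 : (0 : R) < (2 ^ m)%:R ^+ 2 by rewrite exprn_gt0// ltr0n expn_gt0.
apply/andP; split; rewrite -lee_fin fineK ?nu_fin//.
  rewrite -nuU; apply: le_measure; rewrite ?inE//.
  move=> [x y] [[i j] /= ij] [/= /(kap_itv_set_itv ha)[xi x01]].
  move=> /(kap_itv_set_itv ha)[yj y01].
  by split=> //; have [+ _] := rho_kap_near r ha hl x01 y01 xi yj; exact.
set P := kap_near _ _ _ _.
(* The level-[m] intervals do not cover [[0, 1]], so the upper bound passes to the complement: the
   correlation set is disjoint from the rectangles of the pairs that are not near. *)
have -> : (count_pairs P (2 ^ m))%:R / (2 ^ m)%:R ^+ 2 =
    1 - (count_pairs (fun i j => ~~ P i j) (2 ^ m))%:R / (2 ^ m)%:R ^+ 2 :> R.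
  have : (count_pairs P (2 ^ m) + count_pairs (fun i j => ~~ P i j) (2 ^ m)
      = (2 ^ m) ^ 2)%N.
    rewrite -!card_count_pairs -[X in (X ^ 2)%N]card_ord expnS expn1 -card_prod.
    exact: cardC.
  move=> /(congr1 (fun n => n%:R : R)); rewrite natrD natrX => e.
  by rewrite -[X in X - _](divff (lt0r_neq0 N0)) -mulrBl -e addrK.
rewrite EFinB -nuU -nuT leeBrDr ?nu_fin//.
rewrite -measureU//; first by apply: le_measure; rewrite ?inE//; exact: measurableU.
apply/seteqP; split=> // -[x y] /= [[/= x01 y01 xy]] [[i j] /= /negP ij].
move=> [/= /(kap_itv_set_itv ha)[xi _] /(kap_itv_set_itv ha)[yj _]]; apply: ij.
by have [_ +] := rho_kap_near r ha hl x01 y01 xi yj; exact.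
Qed.

Theorem lemma24 (R : realType) (alpha : R) (halpha : 0 < alpha < 1 / 2)
  (mu : probability (measurableTypeR R) R) (hmu : is_mu_alpha alpha mu)
  (r : R) (hr : 0 < r <= 1)
  (l : option nat) (hl : if l is Some m then (1 <= m)%N else true) :
  corr_sum (f_alpha alpha) l 0 n r @[n --> \oo]
    --> corr_integral (f_alpha alpha) mu l r.
Proof.
have [K hK] := count_pairs_kap_near_boundary r l halpha.
apply/cvgrPdist_le => e e0.
(* Chosen so that [2 * K / e < m.+1] style growth suffices: [2 * K / e < m < 2 ^ m], which leaves at
   most [e / 2] for the boundary pairs. The threshold on [n] below leaves [e / 2] for the incomplete
   period. *)
pose m := (Num.truncn (2 * K%:R / e)).+1.
pose N := (2 ^ m)%N.
have N0 : (0 < N)%N by rewrite expn_gt0.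
have KN : K%:R / N%:R <= e / 2.
  have : 2 * K%:R / e < N%:R.
    by rewrite (lt_le_trans (truncnS_gt _))// ler_nat ltnW// ltn_expl.
  rewrite ltr_pdivrMr// => h; rewrite ler_pdivrMr ?ltr0n//; lra.
exists (N + Num.truncn (6 * N%:R / e)).+1 => //= n /= hn.
have Nn : (N <= n)%N by rewrite (leq_trans _ hn)// leqW// leq_addr.
have n0 : (0 : R) < n%:R by rewrite ltr0n (leq_trans N0).
have tn : 3 * (N%:R / n%:R) <= e / 2.
  have : 6 * N%:R / e < n%:R.
    rewrite (lt_le_trans (truncnS_gt _))// ler_nat (leq_trans _ hn)//.
    by rewrite ltnS leq_addl.
  rewrite ltr_pdivrMr// => h.
  by rewrite mulrA ler_pdivrMr//; lra.
set d := alpha ^+ m.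
have /andP[c1 c2] := corr_integral_bounds r halpha hl hmu (ltn0Sn _ : 0 < m)%N.
(* The orbit starts at the left end of the interval of residue 0, so at time [i] it is in the
   interval of residue [i]. *)
have X i : kap alpha m i <= iter i (f_alpha alpha) 0 <= kap alpha m i + alpha ^+ m.
  apply: (iter_f_alpha_kap (n := 0%N)) => //.
  by rewrite kap_0 add0r lexx exprn_ge0; lra.
have X01 i : 0 <= iter i (f_alpha alpha) 0 <= 1.
  by apply: iter_f_alpha_itv => //; lra.
have ratio (t : R) := count_pairs_ratio R (kap_near_modl alpha t l m)
  (kap_near_modr alpha t l m) N0 Nn.
have /andP[lo _] := ratio (r - d); have /andP[_ hi] := ratio (r + d).
have n2 : 0 < (n%:R : R) ^+ 2 by rewrite exprn_gt0.
have N2 : 0 < (N%:R : R) ^+ 2 by rewrite exprn_gt0// ltr0n.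
rewrite /corr_sum.
rewrite (card_count_pairs (fun i j => rho (f_alpha alpha) l
  (iter i (f_alpha alpha) 0) (iter j (f_alpha alpha) 0) <= r)).
set C := count_pairs _ n.
have C1 : (count_pairs (kap_near alpha l m (r - d)) n)%:R / n%:R ^+ 2 <=
    C%:R / n%:R ^+ 2 :> R.
  rewrite ler_pM2r ?invr_gt0// ler_nat; apply: count_pairs_le => i j.
  by have [+ _] := rho_kap_near r halpha hl (X01 i) (X01 j) (X i) (X j); exact.
have C2 : C%:R / n%:R ^+ 2 <=
    (count_pairs (kap_near alpha l m (r + d)) n)%:R / n%:R ^+ 2 :> R.
  rewrite ler_pM2r ?invr_gt0// ler_nat; apply: count_pairs_le => i j.
  by have [_ +] := rho_kap_near r halpha hl (X01 i) (X01 j) (X i) (X j); exact.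
(* The correlation integral lies between these two densities over one period, and the correlation
   sum does too up to [3 * (N / n)]; their gap [K / N] is thus the only other error. *)
have bd : (count_pairs (kap_near alpha l m (r + d)) N)%:R / N%:R ^+ 2 <=
    (count_pairs (kap_near alpha l m (r - d)) N)%:R / N%:R ^+ 2 + K%:R / N%:R :> R.
  have -> : K%:R / N%:R = (K * N)%:R / N%:R ^+ 2 :> R.
    by rewrite natrM; field; rewrite pnatr_eq0 -lt0n.
  rewrite -mulrDl ler_pM2r ?invr_gt0// -natrD ler_nat.
  apply: leq_trans (count_pairs_leD _ (kap_near alpha l m (r - d)) _) _.
  by rewrite leq_add2l.
by rewrite ler_norml; apply/andP; split; lra.
Qed.
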